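(* Let $A=\{\alpha(0),\dots,\alpha(n),y\}\subset\mathbb{Z}^n$ with $\alpha(0)=0$ be a circuit such that $\Delta=\operatorname{conv}\{\alpha(0),\dots,\alpha(n)\}$ is an $n$-dimensional simplex and $y\in\operatorname{int}(\Delta)$, with $y=\sum_{j=0}^n\lambda_j\alpha(j)$, $\sum_{j=0}^n\lambda_j=1$, $\lambda_j>0$. Let $f=\sum_{j=0}^n b_j\mathbf{x}^{\alpha(j)}+c\,\mathbf{x}^y$ with $b_j\in\mathbb{R}_{>0}$, $c\in\mathbb{R}\setminus\{0\}$ and $b_0=\lambda_0$. Let $e^{\mathbf{s}^*}$ denote the global (norm) minimizer and $\Theta_f$ the circuit number of $f$. Then the Gale dual $M^B$ of the support matrix $M^A$ is an integral multiple of the vector $$\left(b_0e^{\langle\mathbf{s}^*,\alpha(0)\rangle},\dots,b_ne^{\langle\mathbf{s}^*,\alpha(n)\rangle},-\Theta_f\,e^{\langle\mathbf{s}^*,y\rangle}\right)\in\mathbb{R}^{n+2}.$$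
   Context: $A$ is a circuit if it is affinely dependent but every proper subset is affinely independent. The support matrix $M^A\in\mathbb{Z}^{(n+1)\times(n+2)}$ has as columns the vectors $(1,\alpha(0)),\dots,(1,\alpha(n)),(1,y)$. A Gale dual of $M^A$ is an integral vector $M^B\in\mathbb{Z}^{n+2}$ that generates the $\mathbb{Z}$-kernel $\{\mathbf{v}\in\mathbb{Z}^{n+2}: M^A\mathbf{v}=0\}$. The circuit number is $\Theta_f=\prod_{j=0}^n(b_j/\lambda_j)^{\lambda_j}$. The vector $\mathbf{s}^*\in\mathbb{R}^n$ is the unique solution of $e^{\langle\mathbf{s}^*,\alpha(j)\rangle}=\lambda_j/b_j$ for all $1\le j\le n$, and $e^{\mathbf{s}^*}=(e^{s_1^*},\dots,e^{s_n^*})$. *)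

(* Defs.v *)
From HB Require Import structures.
From mathcomp Require Import all_boot all_order all_algebra finmap.
From mathcomp Require Import all_classical all_reals all_analysis.
(* Only the canonical instances: the notations of monalg clash with those of
   MathComp-Analysis. *)
From mathcomp Require Import (canonicals) monalg.
Set Implicit Arguments.
Unset Strict Implicit.
Unset Printing Implicit Defensive.
Import Order.TTheory GRing.Theory Num.Theory.
Import numFieldNormedType.Exports.
Local Open Scope classical_set_scope.
Local Open Scope fset_scope.
Local Open Scope ring_scope.

Definition realpt (R : realType) (n : nat) (a : 'rV[int]_n) : 'rV[R]_n :=
  map_mx intr a.

Definition pairing (R : realType) (n : nat) (s : 'rV[R]_n) (a : 'rV[int]_n) : R :=
  \sum_(i < n) s ord0 i * (a ord0 i)%:~R.

(* A finite set of points, so a listing with repetitions collapses. *)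
Definition affinely_independent (R : realType) (n : nat) (V : {fset 'rV[R]_n})
    : Prop :=
  forall mu : 'rV[R]_n -> R,
    \sum_(v <- V) mu v = 0 -> \sum_(v <- V) mu v *: v = 0 ->
    forall v, v \in V -> mu v = 0.

Definition convex_hull (R : realType) (n : nat) (V : {fset 'rV[R]_n})
    : set 'rV[R]_n :=
  [set x | exists t : 'rV[R]_n -> R,
    [/\ forall v, v \in V -> 0 <= t v,
        \sum_(v <- V) t v = 1
      & x = \sum_(v <- V) t v *: v]].

Definition is_simplex (R : realType) (n d : nat) (S : set 'rV[R]_n) : Prop :=
  exists V : {fset 'rV[R]_n},
    [/\ #|` V| = d.+1, affinely_independent V & S = convex_hull V].

Definition is_circuit (R : realType) (n : nat) (V : {fset 'rV[R]_n}) : Prop :=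
  ~ affinely_independent V /\
  forall W : {fset 'rV[R]_n}, W `<` V -> affinely_independent W.

(* Real Laurent polynomials in n variables, as finitely supported coefficient
   functions on the exponent lattice. *)
Notation laurent R n := (monalg.malg 'rV[int]_n R).

Definition monomial (R : realType) (n : nat) (c : R) (a : 'rV[int]_n) : laurent R n :=
  monalg.mkmalgU a c.

Definition coef (R : realType) (n : nat) (f : laurent R n) (a : 'rV[int]_n) : R :=
  monalg.mcoeff a f.

Definition circuit_polynomial (R : realType) (n : nat)
    (alpha : 'I_n.+1 -> 'rV[int]_n) (y : 'rV[int]_n)
    (b : 'I_n.+1 -> R) (c : R) : laurent R n :=
  \sum_(j < n.+1) monomial (b j) (alpha j) + monomial c y.

Definition circuit_number (R : realType) (n : nat) (alpha : 'I_n.+1 -> 'rV[int]_n)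
    (lambda : 'I_n.+1 -> R) (f : laurent R n) : R :=
  \prod_(j < n.+1) (coef f (alpha j) / lambda j) `^ lambda j.

(* The vector s is determined by the coefficients of f at alpha(1), ..., alpha(n)
   alone: the coefficient at y plays no role.  Under the normalization
   b_0 = lambda_0, exp(s) is the global minimizer of f on the positive orthant
   exactly when the coefficient at y is - circuit_number f. *)
Definition norm_minimizer (R : realType) (n : nat) (alpha : 'I_n.+1 -> 'rV[int]_n)
    (lambda : 'I_n.+1 -> R) (f : laurent R n) (s : 'rV[R]_n) : Prop :=
  forall j : 'I_n.+1, j != ord0 ->
    expR (pairing s (alpha j)) = lambda j / coef f (alpha j).

(* The columns are (1, alpha(0)), ..., (1, alpha(n)), (1, y); the width n + 2 is
   written n.+1 + 1 to match the block decomposition. *)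
Definition support_matrix (n : nat) (alpha : 'I_n.+1 -> 'rV[int]_n)
    (y : 'rV[int]_n) : 'M[int]_(1 + n, n.+1 + 1) :=
  row_mx (col_mx (const_mx 1) (\matrix_(i < n, j < n.+1) alpha j ord0 i))
         (col_mx (const_mx 1) y^T).

Definition is_gale_dual (m p : nat) (MA : 'M[int]_(m, p)) (MB : 'cV[int]_p) : Prop :=
  forall v : 'cV[int]_p, MA *m v = 0 <-> exists k : int, v = k *: MB.

(* Main.v *)
Require Import Defs.
From HB Require Import structures.
From mathcomp Require Import all_boot all_order all_algebra finmap.
From mathcomp Require Import all_classical all_reals all_analysis.
(* Only the canonical instances: the notations of monalg clash with those used
   below. *)
From mathcomp Require Import (canonicals) monalg.
Set Implicit Arguments.
Unset Strict Implicit.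
Unset Printing Implicit Defensive.
Import Order.TTheory GRing.Theory Num.Theory.
Import numFieldNormedType.Exports.
Local Open Scope classical_set_scope.
Local Open Scope fset_scope.
Local Open Scope ring_scope.

(** With the normalization [b ord0 = lambda ord0], the defining equations of [s]
    hold at every vertex: [b j * expR (pairing s (alpha j)) = lambda j] for all
    [j], the case [alpha ord0 = 0] being the normalization itself.  Taking the
    product of the powers [lambda j] of [b j / lambda j] gives
    [expR (- pairing s y)], because [y] is the combination of the [alpha j] with
    weights [lambda j] ([pairing_comb]).  So the circuit number times
    [expR (pairing s y)] is [1], and the vector of the theorem is nothing but
    [(lambda, -1)]: the barycentric relation between [y] and the vertices.

    It remains to see that a Gale dual is a multiple of [(lambda, -1)].
    Appending a coordinate [1] to every point turns affine relations into linear
    ones, and makes the support matrix the transpose of the matrix of these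
    lifted points.  The vertices of a simplex have linearly independent lifts
    ([simplex_row_free]), so a relation among the lifts of the [alpha j] and [y]
    is determined by its last entry [d]: it is [- d] times [(lambda, -1)]
    ([support_kernel]).  For a Gale dual [d] is an integer entry, which gives the
    integral multiple.

    All of this reads [b j] off the polynomial as its coefficient at [alpha j],
    so the exponents must be distinct.  The [alpha j] are distinct since their
    lifts are independent; and if [y] were one of them, the whole configuration
    would be the vertex set of the simplex, which is affinely independent
    ([row_free_affinely_independent]) and hence not a circuit. *)

(** The lift of a point to the hyperplane of height 1, where affine combinations
    become linear ones. *)
Definition homog (R : realType) (n : nat) (v : 'rV[R]_n) : 'rV[R]_(1 + n) :=
  row_mx (const_mx 1) v.

Definition homog_mx (R : realType) (m n : nat) (p : 'I_m -> 'rV[R]_n) :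
    'M[R]_(m, 1 + n) :=
  \matrix_(j < m) homog (p j).

Lemma sum_homog (R : realType) (n : nat) (I : Type) (r : seq I) (t : I -> R)
    (q : I -> 'rV[R]_n) :
  \sum_(i <- r) t i *: homog (q i) =
  row_mx (const_mx (\sum_(i <- r) t i)) (\sum_(i <- r) t i *: q i).
Proof.
elim: r => [|i r IHr].
  by rewrite !big_nil; apply/eqP; rewrite eq_sym row_mx_eq0 !eqxx.
rewrite !big_cons IHr /homog scale_row_mx add_row_mx; congr row_mx.
by apply/rowP => j; rewrite !mxE mulr1.
Qed.

Lemma mul_homog_mx (R : realType) (m n : nat) (p : 'I_m -> 'rV[R]_n)
    (u : 'rV[R]_m) :
  u *m homog_mx p =
  row_mx (const_mx (\sum_j u ord0 j)) (\sum_j u ord0 j *: p j).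
Proof.
by rewrite mulmx_sum_row -sum_homog; apply: eq_bigr => j _; rewrite rowK.
Qed.

(** Affine independence of a finite set, transported to an indexed family, where
    ranks are available. *)
Lemma row_free_homog_enum (R : realType) (n : nat) (V : {fset 'rV[R]_n}) :
  affinely_independent V ->
  row_free (homog_mx (fun i : 'I_#|` V| => nth 0 (enum_fset V) i)).
Proof.
move=> indV; apply: inj_row_free => u; rewrite mul_homog_mx.
move/eqP; rewrite row_mx_eq0 => /andP[/eqP u0 /eqP uV].
pose mu v := if insub (index v (enum_fset V)) is Some i then u ord0 i else 0.
have muE (i : 'I_#|` V|) : mu (nth 0 (enum_fset V) i) = u ord0 i.
  by rewrite /mu index_uniq ?fset_uniq // valK.
have mu0 : forall v, v \in V -> mu v = 0.
  apply: indV; rewrite (big_nth 0) big_mkord.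
    under eq_bigr do rewrite muE.
    by move/rowP/(_ ord0): u0; rewrite !mxE.
  by under eq_bigr do rewrite muE.
by apply/rowP => i; rewrite -muE mu0 ?mxE // mem_nth.
Qed.

(** Convexity only matters through this inclusion of row spaces, by which ranks
    bound the dimension of a convex hull. *)
Lemma convex_hull_homog (R : realType) (m n : nat) (p : 'I_m -> 'rV[R]_n)
    (x : 'rV[R]_n) :
  convex_hull [fset p j | j : 'I_m] x -> (homog x <= homog_mx p)%MS.
Proof.
case=> t [_ t1 ->]; rewrite /homog -t1 -sum_homog big_seq.
apply: summx_sub => v /imfsetP[j _ ->].
by apply: scalemx_sub; rewrite -(rowK (fun j => homog (p j))) row_sub.
Qed.

Lemma mem_convex_hull (R : realType) (n : nat) (V : {fset 'rV[R]_n})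
    (x : 'rV[R]_n) : x \in V -> convex_hull V x.
Proof.
move=> xV; exists (fun v => (v == x)%:R); split=> [v _||].
- exact: ler0n.
- rewrite (big_fsetD1 x) //= eqxx big_seq big1 ?addr0 // => v.
  by rewrite !inE => /andP[/negPf ->].
- rewrite (big_fsetD1 x) //= eqxx scale1r big_seq big1 ?addr0 // => v.
  by rewrite !inE => /andP[/negPf ->]; rewrite scale0r.
Qed.

(** A simplex is presented by some set [V] of affinely independent points, which
    is not assumed to be the set of the [p j].  Since [V] lies in the hull of the
    [p j], the [n.+1] independent lifts of [V] are in the span of the [n.+1] lifts
    of the [p j]; the latter then have full rank. *)
Lemma simplex_row_free (R : realType) (n : nat) (p : 'I_n.+1 -> 'rV[R]_n) :
  is_simplex n (convex_hull [fset p j | j : 'I_n.+1]) ->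
  row_free (homog_mx p).
Proof.
case=> V [cardV indV hullE].
have freeV := row_free_homog_enum indV.
rewrite -row_leq_rank -{1}cardV -(eqP freeV); apply: mxrankS.
apply/row_subP => i; rewrite rowK; apply: convex_hull_homog.
by rewrite hullE; apply: mem_convex_hull; rewrite mem_nth.
Qed.

Lemma row_free_injective (R : realType) (m n : nat) (p : 'I_m -> 'rV[R]_n) :
  row_free (homog_mx p) -> injective p.
Proof.
move=> freep i j pij; apply/eqP; rewrite eq_sym.
have : delta_mx 0 i = delta_mx 0 j :> 'rV[R]_m.
  by apply: (row_free_inj freep); rewrite -!rowE !rowK pij.
move/rowP/(_ i); rewrite !mxE !eqxx eq_sym /=.
by case: (j == i) => // /eqP; rewrite oner_eq0.
Qed.

Lemma row_free_affinely_independent (R : realType) (m n : nat)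
    (p : 'I_m -> 'rV[R]_n) :
  row_free (homog_mx p) -> affinely_independent [fset p j | j : 'I_m].
Proof.
move=> freep mu.
have injp := row_free_injective freep.
rewrite !big_imfset /=; try by move=> i j _ _; apply: injp.
rewrite !big_enum /= => mu0 muV v /imfsetP[j _ ->].
have : (\row_j mu (p j)) *m homog_mx p = 0.
  rewrite mul_homog_mx; under eq_bigr do rewrite mxE.
  under [X in row_mx _ X]eq_bigr do rewrite mxE.
  by rewrite mu0 muV; apply/eqP; rewrite row_mx_eq0 !eqxx.
move/eqP; rewrite mulmx_free_eq0 // => /eqP/rowP/(_ j).
by rewrite !mxE.
Qed.

(** Distinctness of the exponents is essential: monomials with equal exponents
    would add up. *)
Lemma coef_circuit_polynomial (R : realType) (n : nat)
    (alpha : 'I_n.+1 -> 'rV[int]_n) (y : 'rV[int]_n)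
    (b : 'I_n.+1 -> R) (c : R) (j : 'I_n.+1) :
  injective alpha -> alpha j != y ->
  coef (circuit_polynomial alpha y b c) (alpha j) = b j.
Proof.
move=> inja jy; rewrite /coef /circuit_polynomial /monomial.
rewrite monalg.mcoeffD raddf_sum /= monalg.mcoeffU eq_sym (negPf jy) addr0.
rewrite (bigD1 j) //= monalg.mcoeffU eqxx big1 ?addr0 // => i ij.
by rewrite monalg.mcoeffU (inj_eq inja) (negPf ij).
Qed.

Lemma pairing_comb (R : realType) (n m : nat) (alpha : 'I_m -> 'rV[int]_n)
    (y : 'rV[int]_n) (lambda : 'I_m -> R) (s : 'rV[R]_n) :
  realpt R y = \sum_(j < m) lambda j *: realpt R (alpha j) ->
  \sum_(j < m) lambda j * pairing s (alpha j) = pairing s y.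
Proof.
move=> hy; under eq_bigr do rewrite mulr_sumr.
rewrite exchange_big; apply: eq_bigr => i _ /=.
move/rowP/(_ i): hy; rewrite mxE summxE => ->; rewrite mulr_sumr.
by apply: eq_bigr => j _; rewrite !mxE mulrCA.
Qed.

Lemma map_support_matrix (R : realType) (n : nat)
    (alpha : 'I_n.+1 -> 'rV[int]_n) (y : 'rV[int]_n) :
  map_mx intr (support_matrix alpha y) =
  row_mx (homog_mx (fun j => realpt R (alpha j)))^T (homog (realpt R y))^T.
Proof.
rewrite /support_matrix map_row_mx !map_col_mx /homog tr_row_mx.
congr row_mx; last first.
  by congr col_mx; apply/matrixP => i j; rewrite !mxE.
apply/matrixP => i j; rewrite !mxE.
by case: splitP => k _; rewrite !mxE.
Qed.

(** The lift of [y] is the combination of the lifts of the vertices with weights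
    [lambda]; substituting it in a relation [(u, d)] leaves the relation
    [u + d lambda] among the independent lifts of the vertices, which must
    vanish. *)
Lemma support_kernel (R : realType) (n : nat)
    (alpha : 'I_n.+1 -> 'rV[int]_n) (y : 'rV[int]_n) (lambda : 'I_n.+1 -> R)
    (v : 'cV[int]_(n.+1 + 1)) :
  row_free (homog_mx (fun j => realpt R (alpha j))) ->
  realpt R y = \sum_(j < n.+1) lambda j *: realpt R (alpha j) ->
  \sum_(j < n.+1) lambda j = 1 ->
  support_matrix alpha y *m v = 0 ->
  map_mx intr v =
  (- dsubmx v ord0 ord0)%:~R *: col_mx (\col_j lambda j) (const_mx (- 1))
    :> 'cV[R]__.
Proof.
move=> freea hy hsum /(congr1 (map_mx (intr : int -> R))).
rewrite map_mxM map_support_matrix map_mx0 -[v]vsubmxK map_col_mx.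
set u := map_mx _ (usubmx v); set d := dsubmx v ord0 ord0.
have -> : map_mx intr (dsubmx v) = (d%:~R)%:M :> 'M[R]_1.
  by rewrite [dsubmx v]mx11_scalar map_scalar_mx.
rewrite col_mxKd mul_row_col mul_mx_scalar.
move/(congr1 trmx); rewrite linearD /= trmx_mul trmxK linearZ /= trmxK trmx0.
have -> : homog (realpt R y) =
    (\row_j lambda j) *m homog_mx (fun j => realpt R (alpha j)).
  rewrite mul_homog_mx /homog hy -[in LHS]hsum.
  by congr row_mx; [congr const_mx|]; apply: eq_bigr => j _; rewrite mxE.
rewrite scalemxAl -mulmxDl; move/eqP; rewrite mulmx_free_eq0 // => /eqP u0.
rewrite scale_col_mx; congr col_mx; apply/colP => i.
  move/rowP/(_ i): u0; rewrite !mxE => /eqP; rewrite addr_eq0 => /eqP ->.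
  by rewrite rmorphN mulNr /d !mxE.
by rewrite [i]ord1 -/d !mxE eqxx mulr1n rmorphN mulrN1 opprK.
Qed.

Theorem corollary3p10 (R : realType) (n : nat)
    (alpha : 'I_n.+1 -> 'rV[int]_n) (y : 'rV[int]_n)
    (lambda b : 'I_n.+1 -> R) (c : R) (f : laurent R n)
    (s : 'rV[R]_n) (MB : 'cV[int]_(n.+1 + 1))
    (halpha0 : alpha ord0 = 0)
    (hcircuit : is_circuit (realpt R y |` [fset realpt R (alpha j) | j : 'I_n.+1]))
    (hsimplex : is_simplex n (convex_hull [fset realpt R (alpha j) | j : 'I_n.+1]))
    (hint : interior (convex_hull [fset realpt R (alpha j) | j : 'I_n.+1])
                     (realpt R y))
    (hy : realpt R y = \sum_(j < n.+1) lambda j *: realpt R (alpha j))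
    (hsum : \sum_(j < n.+1) lambda j = 1)
    (hlambda : forall j, 0 < lambda j)
    (hf : f = circuit_polynomial alpha y b c)
    (hb : forall j, 0 < b j)
    (hc : c != 0)
    (hb0 : b ord0 = lambda ord0)
    (hs : norm_minimizer alpha lambda f s)
    (hMB : is_gale_dual (support_matrix alpha y) MB) :
  exists k : int,
    map_mx intr MB =
    k%:~R *: col_mx (\col_(j < n.+1) (b j * expR (pairing s (alpha j))))
                    (const_mx (- (circuit_number alpha lambda f
                                  * expR (pairing s y)))).
Proof.
have freea := simplex_row_free (p := fun j => realpt R (alpha j)) hsimplex.
have inja : injective alpha.
  by move=> i j aij; apply: (row_free_injective freea); rewrite aij.
have ay j : alpha j != y.
  apply/eqP => jy; case: hcircuit => + _; apply.
  suff -> : realpt R y |` [fset realpt R (alpha j) | j : 'I_n.+1] =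
            [fset realpt R (alpha j) | j : 'I_n.+1].
    exact: row_free_affinely_independent.
  by apply/fsetUidPr; rewrite fsub1set -jy; apply/imfsetP; exists j.
have coefE j : coef f (alpha j) = b j.
  by rewrite hf coef_circuit_polynomial.
have expE j : expR (pairing s (alpha j)) = lambda j / b j.
  have [->|j0] := eqVneq j ord0; last by rewrite hs ?coefE.
  rewrite hb0 divff ?gt_eqF // halpha0 /pairing big1 ?expR0 // => i _.
  by rewrite mxE mulr0.
(* Each factor of the circuit number is [expR (- lambda j * pairing s (alpha j))]. *)
have thetaE : circuit_number alpha lambda f * expR (pairing s y) = 1.
  rewrite -(pairing_comb s hy) expR_sum -big_split /= big1 // => j _.
  rewrite coefE -invf_div -expE -expRN -expRM [lambda j * _]mulrC.
  by rewrite -expRD mulNr addNr expR0.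
have MB0 : support_matrix alpha y *m MB = 0.
  by apply/hMB; exists 1; rewrite scale1r.
exists (- dsubmx MB ord0 ord0).
rewrite (support_kernel freea hy hsum MB0) thetaE; congr (_ *: col_mx _ _).
by apply/colP => j; rewrite !mxE expE mulrC divfK ?gt_eqF.
Qed.
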